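(* Let $p\in[1,2]$, $k\ge1$ an integer, $\varepsilon\in(0,1)$, and $\delta=\operatorname{tail}(2.01\cdot 66)$ (an absolute constant). Any algorithm that accesses a real square matrix ${\bm{A}}$ via matrix-vector multiplication queries, where the query vectors may be adaptively chosen and their entries are specified by $k$ bits, and that for every real square matrix ${\bm{A}}$ outputs an estimate $t$ such that with probability at least $1-\delta/2$, $|t-\operatorname{tr}({\bm{A}})|\le\varepsilon\|{\bm{A}}\|_p$, requires at least $$\Omega\!\left(\frac{1}{\varepsilon^p(k+\log(1/\varepsilon))}\right)$$ queries.
   Context: $\operatorname{tail}(x)=\frac{1}{\sqrt{2\pi}}\int_x^\infty e^{-s^2/2}\,ds$ is the standard normal tail probability. $\|\cdot\|_p$ is the Schatten-$p$ norm (the $\ell_p$ norm of the singular values). In the matrix-vector query model the algorithm chooses vectors $q_1,q_2,\dots$, each possibly depending on previous answers, and receives ${\bm{A}}q_1,{\bm{A}}q_2,\dots$; each entry of each query vector is specified using $k$ bits. *)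

(* Defs.v *)
From HB Require Import structures.
From mathcomp Require Import all_boot all_order all_algebra.
From mathcomp Require Import sesquilinear spectral complex.
From mathcomp Require Import all_classical all_reals all_analysis.

Set Implicit Arguments.
Unset Strict Implicit.
Unset Printing Implicit Defensive.

Import Order.TTheory GRing.Theory Num.Theory.
Import numFieldNormedType.Exports.

Local Open Scope classical_set_scope.
Local Open Scope ring_scope.
Local Open Scope sesquilinear_scope.

Definition normal_tail (R : realType) (x : R) : R :=
  (Num.sqrt (2 * pi))^-1 *
  (\int[@lebesgue_measure R]_(s in `[x, +oo[) expR (- (s ^+ 2 / 2)))%R.

(* The spectral theorem of the library lives over an algebraically closed field,
   so A^T A is viewed in R[i]; spectral_diag lists its (real, nonnegative)
   eigenvalues with multiplicity: see char_poly_singular_value. *)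
Definition singular_value (R : realType) (n : nat) (A : 'M[R]_n) (i : 'I_n) : R :=
  Num.sqrt
    (complex.Re (spectral_diag (map_mx (real_complex R) (A^T *m A)) ord0 i)).

Lemma char_poly_singular_value (R : realType) (n : nat) (A : 'M[R]_n) :
  char_poly (A^T *m A) = \prod_(i < n) ('X - (singular_value A i ^+ 2)%:P).
Proof.
apply: (@map_poly_inj _ _ (real_complex R)).
rewrite map_char_poly rmorph_prod /=.
set Ac := map_mx (real_complex R) A.
have AcE : Ac^T ^ Num.conj = Ac^T.
  by apply/matrixP => i j; rewrite !mxE; exact: conjc_real.
set B := map_mx (real_complex R) (A^T *m A).
have BE : B = Ac^T *m Ac by rewrite /B map_mxM map_trmx.
have Bn : B \is normalmx.
  apply/normalmxP.
  suff -> : B^t* = B by [].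
  rewrite BE trmx_mul trmxK map_mxM AcE; congr (_ *m _).
  by apply/matrixP => i j; rewrite !mxE; exact: conjc_real.
have := Bn => /orthomx_spectralP; set P := spectralmx B; set sp := spectral_diag B.
move=> Beq.
have Pu : P \is unitarymx by exact: spectral_unitarymx.
have PU : P \in unitmx by exact: spectral_unit.
have dE : diag_mx sp = P *m B *m P^t*.
  by rewrite {1}Beq -invmx_unitary// !mulmxA mulmxV// mul1mx mulmxK.
have sp_ge0 i : 0 <= sp ord0 i.
  have : diag_mx sp i i = sp ord0 i by rewrite mxE eqxx mulr1n.
  move=> <-; rewrite dE BE.
  have -> : P *m (Ac^T *m Ac) *m P^t* = (P *m Ac^T) *m (P *m Ac^T)^t*.
    rewrite trmx_mul trmxK map_mxM !mulmxA; congr (_ *m _ *m _).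
    by apply/matrixP => a b; rewrite !mxE; exact/esym/conjc_real.
  rewrite mxE sumr_ge0// => j _; rewrite [X in _ * X]mxE [X in _ * Num.conj X]mxE.
  exact: mul_conjC_ge0.
have -> : char_poly B = char_poly (diag_mx sp).
  rewrite Beq /char_poly /char_poly_mx.
  have hu : map_mx polyC P \in unitmx by rewrite map_unitmx.
  have -> : 'X%:M - map_mx polyC (invmx P *m diag_mx sp *m P) =
    map_mx polyC (invmx P) *m ('X%:M - map_mx polyC (diag_mx sp)) *m map_mx polyC P.
    rewrite mulmxBr mulmxBl !map_mxM; congr (_ - _).
    by rewrite -mulmxA mul_scalar_mx -scalemxAr -map_mxM mulVmx// map_mx1 scalemx1.
  rewrite !det_mulmx mulrC mulrA -det_mulmx -map_mxM mulmxV// map_mx1 det1 mul1r.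
  by [].
rewrite char_poly_trig ?diag_mx_is_trig//; apply: eq_bigr => i _.
rewrite rmorphB/= map_polyX map_polyC/= mxE eqxx mulr1n; congr (_ - _%:P).
rewrite /singular_value sqr_sqrtr -/B -/sp; last first.
  by move: (sp_ge0 i); rewrite lecE => /andP[].
by rewrite [RHS]RRe_real// ger0_real.
Qed.

Definition schatten_norm (R : realType) (p : R) (n : nat) (A : 'M[R]_n) : R :=
  (\sum_(i < n) singular_value A i `^ p) `^ p^-1.

(* A randomized adaptive algorithm for n x n matrices making m queries, with
   random seed in Omega.  The i-th query (i counted from 0) is a function of the
   seed and of the i previous answers, and the algorithm returns, for each of the
   n entries, a string of k bits; decode_bits is the number format, which is
   arbitrary.  The output is a function of the seed and of the m answers. *)
Record mv_algorithm (R : realType) (d : measure_display) (Omega : measurableType d)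
    (k n m : nat) := MVAlgorithm {
  decode_bits : k.-tuple bool -> R;
  query : forall i : nat,
    Omega * i.-tuple (n.-tuple R) -> n.-tuple (k.-tuple bool);
  output : Omega * m.-tuple (n.-tuple R) -> R;
  measurable_query : forall i : nat, measurable_fun [set: _] (@query i);
  measurable_output : measurable_fun [set: _] output
}.

Section run.
Context (R : realType) (d : measure_display) (Omega : measurableType d).
Context (k n m : nat) (alg : mv_algorithm R Omega k n m) (A : 'M[R]_n) (w : Omega).

Definition query_vector (b : n.-tuple (k.-tuple bool)) : 'cV[R]_n :=
  \col_j decode_bits alg (tnth b j).

Definition answer (q : 'cV[R]_n) : n.-tuple R := [tuple (A *m q) j ord0 | j < n].

Fixpoint transcript (i : nat) : i.-tuple (n.-tuple R) :=
  match i with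
  | 0 => [tuple]
  | j.+1 => [tuple of rcons (transcript j)
               (answer (query_vector (query alg (w, transcript j))))]
  end.

Definition estimate : R := output alg (w, transcript m).

End run.

(* Main.v *)
Require Import Defs.
From HB Require Import structures.
From mathcomp Require Import all_boot all_order all_algebra.
From mathcomp Require Import all_classical all_reals all_analysis.
From mathcomp Require Import measurable_realfun ring lra zify.

(** An algorithm whose queries are q_1, ..., q_m cannot distinguish A from A + B
    when B kills all the q_i.  If 2m <= n, the normalised projection B onto the
    orthogonal complement of the queries has Frobenius norm 1 and trace at least
    sqrt (n / 2), whereas eps times the Schatten norm of a matrix of Frobenius norm
    O(n) is a small multiple of sqrt n as soon as eps n^(1/p) is small; so the
    algorithm fails on A, on A + B or on A - B.  For a Gaussian A the shift by B
    costs only a constant factor in density, hence the failure probability is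
    bounded below and m > n / 2.

    No Gaussian measure is needed.  As the queries are strings of bits, only
    finitely many perturbations B occur; the weight exp (- |A|^2 / 2) is summed over
    the integer combinations, with coefficients in [-L, L], of these B and of the
    elementary matrices.  The number of such combinations is polynomial in L, so for
    some L the sum is almost invariant under the shifts, which is the only property
    of Lebesgue measure that the argument uses. *)

Set Implicit Arguments.
Unset Strict Implicit.
Unset Printing Implicit Defensive.

Import Order.TTheory GRing.Theory Num.Theory.
Import numFieldNormedType.Exports.

Local Open Scope classical_set_scope.
Local Open Scope ring_scope.

(** * Sums over integer boxes in an abelian group *)

Section box_sums.
Context (R : realType) (V : zmodType) (I : finType) (g : I -> V).

(** Points are indexed by their coefficients, so they count with multiplicity when the [g i] are
    dependent; shifts then act injectively on the indices. *)
Definition box_point (L : nat) (z : {ffun I -> 'I_(L.*2.+1)}) : V :=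
  \sum_i g i *~ ((z i)%:Z - L%:Z).

Definition box_sum (L : nat) (h : V -> R) : R := \sum_z h (@box_point L z).

Lemma box_sumD L h1 h2 :
  box_sum L (fun v => h1 v + h2 v) = box_sum L h1 + box_sum L h2.
Proof. exact: big_split. Qed.

Lemma box_sumZ L (a : R) h : box_sum L (fun v => a * h v) = a * box_sum L h.
Proof. by rewrite /box_sum mulr_sumr. Qed.

Lemma box_sum_sum (J : finType) L (h : J -> V -> R) :
  box_sum L (fun v => \sum_j h j v) = \sum_j box_sum L (h j).
Proof. exact: exchange_big. Qed.

Lemma le_box_sum L h1 h2 :
  (forall v, h1 v <= h2 v) -> box_sum L h1 <= box_sum L h2.
Proof. by move=> h12; apply: ler_sum => z _. Qed.

(** The offset [e i - 1] lies in {-1, 0, 1}; adding [e i] to the index embeds the box of size [L]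
    into that of size [L.+1], where the remaining terms are nonnegative. *)
Lemma box_sum_shift_gen L (e : I -> nat) (h : V -> R) :
    (forall i, (e i <= 2)%N) -> (forall v, 0 <= h v) ->
  box_sum L (fun v => h (v + \sum_i g i *~ ((e i)%:Z - 1))) <= box_sum L.+1 h.
Proof.
move=> e2 h0.
have zP (z : {ffun I -> 'I_(L.*2.+1)}) i : (z i + e i < L.+1.*2.+1)%N.
  by have := ltn_ord (z i); have := e2 i; lia.
pose emb z : {ffun I -> 'I_(L.+1.*2.+1)} := [ffun i => Ordinal (zP z i)].
have emb_inj : injective emb.
  move=> z1 z2 /ffunP z12; apply/ffunP => i; apply: val_inj.
  by have /(congr1 val) := z12 i; rewrite !ffunE /= => /addIn.
have embE z : box_point z + \sum_i g i *~ ((e i)%:Z - 1) = box_point (emb z).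
  rewrite /box_point -big_split /=; apply: eq_bigr => i _.
  by rewrite ffunE /= -mulrzDr; congr (_ *~ _); lia.
rewrite /box_sum; under eq_bigr do rewrite embE.
rewrite -(big_imset (fun z => h (box_point z)) (in2W emb_inj)) /=.
rewrite [leRHS](bigID (mem [set emb z | z in [set: _]]%SET)) /=.
rewrite [X in X + _](eq_bigl (mem (emb @: [set: _]%SET))%SET) //.
have -> : (emb @: {ffun I -> 'I_(L.*2.+1)} = emb @: [set: _])%SET.
  by apply/setP => z; apply/imsetP/imsetP => -[y _ ->]; exists y; rewrite ?inE.
by rewrite lerDl sumr_ge0.
Qed.

Lemma box_sumS L (h : V -> R) :
  (forall v, 0 <= h v) -> box_sum L h <= box_sum L.+1 h.
Proof.
move=> h0; have := @box_sum_shift_gen L (fun=> 1%N) h (fun=> isT) h0.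
rewrite big1 => [|i _]; last by rewrite subrr mulr0z.
by under eq_fun do rewrite addr0.
Qed.

Lemma box_sum_shift L i (h : V -> R) :
  (forall v, 0 <= h v) -> box_sum L (fun v => h (v + g i)) <= box_sum L.+1 h.
Proof.
move=> h0.
have := @box_sum_shift_gen L (fun j => 1 + (j == i))%N h _ h0.
suff -> : \sum_j g j *~ ((1 + (j == i))%N%:Z - 1) = g i.
  by apply => j; case: (_ == _).
rewrite (bigD1 i) //= eqxx big1 ?addr0 ?mulr1z // => j /negbTE ->.
by rewrite addn0 subrr mulr0z.
Qed.

Lemma box_sum_shiftN L i (h : V -> R) :
  (forall v, 0 <= h v) -> box_sum L (fun v => h (v - g i)) <= box_sum L.+1 h.
Proof.
move=> h0.
have := @box_sum_shift_gen L (fun j => 1 - (j == i))%N h _ h0.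
suff -> : \sum_j g j *~ ((1 - (j == i))%N%:Z - 1) = - g i.
  by apply => j; case: (_ == _).
rewrite (bigD1 i) //= eqxx big1 ?addr0 ?sub0r ?mulrN1z // => j /negbTE ->.
by rewrite subn0 subrr mulr0z.
Qed.

(* The box has polynomially many points, so its weight cannot grow by a fixed
   factor at every step. *)
Lemma box_sum_growth (f : V -> R) (eta : R) :
    (forall v, 0 <= f v <= 1) -> f 0 = 1 -> 0 < eta ->
  exists L, box_sum L.+1 f <= (1 + eta) * box_sum L f.
Proof.
move=> f01 f0 eta0; apply: contrapT => /forallNP noL.
have growth L : (1 + eta) ^+ L <= box_sum L f.
  elim: L => [|L IH].
    rewrite expr0 /box_sum (bigD1 [ffun=> ord0]) //= {1}/box_point big1.
      by rewrite f0 lerDl sumr_ge0 // => z _; case/andP: (f01 (box_point z)).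
    by move=> i _; rewrite ffunE subrr mulr0z.
  rewrite exprS; apply: (le_trans (ler_wpM2l _ IH)); first by lra.
  by have /negP := noL L; rewrite -ltNge => /ltW.
set r := #|I|; pose a : R := ln (1 + eta).
have a0 : 0 < a by apply: ln_gt0; lra.
have poly L : (0 < L)%N -> box_sum L f <= (3 * L%:R) ^+ r.
  move=> L0; have : box_sum L f <= \sum_(z : {ffun I -> 'I_(L.*2.+1)}) 1.
    by apply: ler_sum => z _; case/andP: (f01 (box_point z)).
  rewrite sumr_const card_ffun card_ord natrX -/r => /le_trans; apply.
  rewrite lerXn2r ?nnegrE ?mulr_ge0 // -natrM ler_nat; lia.
(* [L ^+ r.+1 * D] is the term of degree [r.+1] in the series of [expR (L * a)]; it exceeds the
   polynomial bound [(3 * L) ^+ r] as soon as [L * D > 3 ^+ r]. *)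
pose D : R := a ^+ r.+1 / r.+1`!%:R.
have D0 : 0 < D by rewrite divr_gt0 ?exprn_gt0 // ltr0n fact_gt0.
pose L := (Num.truncn (3 ^+ r / D)).+1.
have LD : 3 ^+ r < L%:R * D.
  by rewrite -ltr_pdivrMr // truncnS_gt.
have := le_trans (growth L) (poly L isT); apply/negP; rewrite -ltNge.
have -> : (1 + eta) ^+ L = expR (L%:R * a) :> R.
  by rewrite mulrC expRM_natr lnK // posrE; lra.
have La0 : 0 <= L%:R * a by rewrite mulr_ge0 // ltW.
apply: lt_le_trans (expR_ge1Dxn r La0).
rewrite !exprMn (exprS L%:R) -!mulrA -/D (mulrCA L%:R) mulrC.
apply: le_lt_trans (_ : _ <= L%:R ^+ r * (L%:R * D)) _.
  by rewrite ler_wpM2l ?exprn_ge0 // ltW.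
by rewrite ltrDr.
Qed.

End box_sums.

(** * Frobenius inner product, Gaussian weight and projections *)

Section frobenius.
Context (R : realType) (n : nat).
Implicit Types A B : 'M[R]_n.

Definition frob_dot A B : R := \tr (A^T *m B).

Definition frob2 A : R := frob_dot A A.

Lemma frob_dotC A B : frob_dot A B = frob_dot B A.
Proof. by rewrite /frob_dot -mxtrace_tr trmx_mul trmxK. Qed.

Lemma frob2D A B : frob2 (A + B) = frob2 A + 2 * frob_dot A B + frob2 B.
Proof.
rewrite /frob2 /frob_dot [(A + B)^T]linearD /= mulmxDl !mulmxDr !mxtraceD.
by rewrite -/(frob_dot B A) frob_dotC /frob_dot; ring.
Qed.

Lemma frob2B A B : frob2 (A - B) = frob2 A - 2 * frob_dot A B + frob2 B.
Proof.
rewrite frob2D /frob2 /frob_dot [(- B)^T]linearN mulmxN mulNmx mulmxN opprK.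
by rewrite [\tr (- _)]linearN; ring.
Qed.

Lemma frob2E A : frob2 A = \sum_i \sum_j A i j ^+ 2.
Proof.
rewrite /frob2 /frob_dot /mxtrace exchange_big /=; apply: eq_bigr => j _.
by rewrite mxE; apply: eq_bigr => i _; rewrite mxE.
Qed.

Lemma frob2_ge0 A : 0 <= frob2 A.
Proof. by rewrite frob2E; do 2 apply: sumr_ge0 => ? _; exact: sqr_ge0. Qed.

Lemma frob_dot_delta A i j : frob_dot A (delta_mx i j) = A i j.
Proof.
rewrite /frob_dot /mxtrace (bigD1 j) //= big1 => [|k kj].
  rewrite addr0 mxE (bigD1 i) //= big1 => [|l li]; rewrite !mxE ?eqxx ?mulr1 ?addr0 //.
  by rewrite (negbTE li) mulr0.
by rewrite mxE big1 // => l _; rewrite !mxE (negbTE kj) andbF mulr0.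
Qed.

Lemma frob2_delta i j : frob2 (delta_mx i j) = 1.
Proof. by rewrite /frob2 frob_dot_delta mxE !eqxx. Qed.

Definition gauss_weight A : R := expR (- (frob2 A / 2)).

Lemma gauss_weight_ge0 A : 0 <= gauss_weight A.
Proof. exact: expR_ge0. Qed.

Lemma gauss_weight_le1 A : gauss_weight A <= 1.
Proof. by rewrite -expR0 ler_expR; have := frob2_ge0 A; lra. Qed.

Lemma gauss_weight0 : gauss_weight 0 = 1.
Proof. by rewrite /gauss_weight /frob2 /frob_dot mulmx0 linear0 mul0r oppr0 expR0. Qed.

(** For x >= 0, e^x + e^(-x) - 2 is the square of e^(x/2) - e^(-x/2), which is at least x/2. *)
Lemma expRDN_ge (x : R) : 2 + x ^+ 2 / 4 <= expR x + expR (- x).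
Proof.
wlog x0 : x / 0 <= x => [H|].
  have [/H //|x0] := leP 0 x.
  have nx0 : 0 <= - x by lra.
  by have := H _ nx0; rewrite opprK sqrrN [expR (- x) + _]addrC.
set u := expR (x / 2); set v := expR (- (x / 2)).
have -> : expR x = u ^+ 2 by rewrite -expRM_natr; congr expR; lra.
have -> : expR (- x) = v ^+ 2 by rewrite -expRM_natr; congr expR; lra.
have uv : u * v = 1 by rewrite expRxMexpNx_1.
have u1 : 1 + x / 2 <= u by exact: expR_ge1Dx.
have v1 : v <= 1 by rewrite -expR0 ler_expR; lra.
have : (x / 2) ^+ 2 <= (u - v) ^+ 2 by rewrite lerXn2r ?nnegrE; lra.
by nra.
Qed.

(** Adding the two signs turns the cross terms into 2 cosh, whose quadratic part will control second
    moments; the factor e^(-1/2) >= 1/2 is the cost of the shift. *)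
Lemma gauss_weight_shift A B : frob2 B = 1 ->
  gauss_weight A * (1 + frob_dot A B ^+ 2 / 8) <=
  gauss_weight (A + B) + gauss_weight (A - B).
Proof.
move=> B1; set x := frob_dot A B.
have -> : gauss_weight (A + B) = gauss_weight A * expR (- (1 / 2)) * expR (- x).
  by rewrite /gauss_weight frob2D B1 -!expRD; congr expR; rewrite -/x; lra.
have -> : gauss_weight (A - B) = gauss_weight A * expR (- (1 / 2)) * expR x.
  by rewrite /gauss_weight frob2B B1 -!expRD; congr expR; rewrite -/x; lra.
rewrite -mulrDr -mulrA ler_wpM2l ?gauss_weight_ge0 //.
have h : 1 / 2 <= expR (- (1 / 2)) :> R.
  by have := expR_ge1Dx (- (1 / 2) : R); lra.
have := expRDN_ge x; have := sqr_ge0 x; move: (expR x) (expR (-x)) (x ^+ 2) => a b c.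
by move: (expR _) h => d; nra.
Qed.

(** Gram-Schmidt: each vector removes from [Q] the projection onto at most one line, which costs at
    most 1 in trace. *)
Lemma complement_projection (s : seq 'cV[R]_n) :
  exists Q : 'M[R]_n, [/\ Q^T = Q, Q *m Q = Q,
    forall q, q \in s -> Q *m q = 0 & n%:R - (size s)%:R <= \tr Q].
Proof.
elim: s => [|q s [Q [Qt QQ Qs trQ]]].
  by exists 1%:M; rewrite trmx1 mul1mx mxtrace1 subr0.
pose v := Q *m q; pose c := (v^T *m v) ord0 ord0.
have vvE : v^T *m v = c%:M by rewrite [LHS]mx11_scalar.
have vqE : v^T *m q = c%:M.
  by rewrite -vvE {2}/v mulmxA /v trmx_mul Qt -[_ *m Q *m Q]mulmxA QQ.
have Qv : Q *m v = v by rewrite /v mulmxA QQ.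
have vQ : v^T *m Q = v^T by rewrite -{1}Qt -trmx_mul Qv.
have [v0|v0] := eqVneq v 0.
  exists Q; split => //.
  - by move=> q'; rewrite inE => /predU1P[->|/Qs //]; exact: v0.
  - by rewrite /= -natr1; lra.
have c0 : c != 0.
  apply: contra_neq v0 => c0; apply/matrixP => i j; rewrite ord1 [RHS]mxE.
  move: c0; rewrite /c mxE => /eqP; rewrite psumr_eq0 => [/allP/(_ i)|k _].
    by rewrite mem_index_enum [v^T _ _]mxE mulf_eq0 orbb => /(_ isT)/eqP.
  by rewrite [v^T _ _]mxE -expr2 sqr_ge0.
pose D := c^-1 *: (v *m v^T).
have DD : D *m D = D.
  rewrite /D -scalemxAl -scalemxAr mulmxA -[v *m v^T *m v]mulmxA vvE.
  by rewrite mul_mx_scalar -scalemxAl scalerA mulVf // scale1r.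
have QD : Q *m D = D by rewrite /D -scalemxAr mulmxA Qv.
have DQ : D *m Q = D by rewrite /D -scalemxAl -mulmxA vQ.
exists (Q - D); split.
- by rewrite linearB /= Qt /D linearZ /= trmx_mul trmxK.
- by rewrite mulmxBl !mulmxBr QQ QD DQ DD subrr subr0.
- move=> q'; rewrite inE mulmxBl => /predU1P[->|/[dup] q's /Qs ->].
    by rewrite -/v /D -scalemxAl -mulmxA vqE mul_mx_scalar scalerA mulVf // scale1r subrr.
  rewrite /D -scalemxAl -mulmxA -{1}vQ -[v^T *m Q *m q']mulmxA Qs //.
  by rewrite !mulmx0 scaler0 subrr.
- rewrite linearB /= /D [\tr (_ *: _)]linearZ /= mxtrace_mulC vvE mxtrace_scalar.
  by rewrite mulr1n mulVf // -natr1; lra.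
Qed.

(* The normalised projection onto the orthogonal complement of the queries. *)
Lemma invisible_perturbation (s : seq 'cV[R]_n) :
    (0 < n)%N -> ((size s).*2 <= n)%N ->
  exists B : 'M[R]_n, [/\ frob2 B = 1, forall q, q \in s -> B *m q = 0 &
    Num.sqrt (n%:R / 2) <= \tr B].
Proof.
move=> n0 sn; have [Q [Qt QQ Qs trQ]] := complement_projection s.
have tQ : n%:R / 2 <= \tr Q.
  apply: le_trans trQ; have : (size s)%:R * 2 <= n%:R :> R.
    by rewrite -natrM ler_nat muln2.
  by lra.
have t0 : 0 < \tr Q by apply: lt_le_trans tQ; rewrite divr_gt0 // ltr0n.
(* Since [Q^T *m Q = Q], [frob2 Q] is [\tr Q]; after this scaling the trace is its square root. *)
exists ((Num.sqrt (\tr Q))^-1 *: Q); split.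
- rewrite /frob2 /frob_dot [(_ *: Q)^T]linearZ /= Qt -scalemxAl -scalemxAr scalerA QQ.
  by rewrite mxtraceZ -expr2 exprVn sqr_sqrtr ?ltW // mulVf ?gt_eqF.
- by move=> q qs; rewrite -scalemxAl Qs // scaler0.
- rewrite linearZ /= -{2}[\tr Q]sqr_sqrtr ?(ltW t0) // expr2 mulrA.
  have r0 : Num.sqrt (\tr Q) != 0 by rewrite gt_eqF // sqrtr_gt0.
  by rewrite mulVf // mul1r ler_wsqrtr.
Qed.

End frobenius.

(** * Singular values and Schatten norms *)

Lemma sum_singular_value_sq (R : realType) (n : nat) (A : 'M[R]_n) :
  \sum_i singular_value A i ^+ 2 = frob2 A.
Proof.
case: n A => [|n] A; first by rewrite frob2E !big_ord0.
(* Both sides are, up to sign, the subleading coefficient of the characteristic polynomial of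
   [A^T *m A]. *)
apply: oppr_inj; rewrite -char_poly_trace // char_poly_singular_value.
pose s := [seq singular_value A i ^+ 2 | i <- index_enum 'I_n.+1].
have sn : size s = n.+1 by rewrite size_map [index_enum _]unlock -enumT size_enum_ord.
have -> : \prod_(i < n.+1) ('X - (singular_value A i ^+ 2)%:P) =
    \prod_(x <- s) ('X - x%:P) by rewrite big_map.
have := coefPn_prod_XsubC (ps := s); rewrite sn => -> //.
by rewrite big_map.
Qed.

(** Concavity of the power function: the bound is its tangent at 1. *)
Lemma powR_tangent (R : realType) (a x : R) :
  0 < a <= 1 -> 0 <= x -> x `^ a <= 1 + a * (x - 1).
Proof.
move=> /andP[a0 a1]; rewrite le_eqVlt => /predU1P[<-|x0].
  by rewrite powR0 ?gt_eqF //; lra.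
have [y ->] : exists y, x = expR y by exists (ln x); rewrite lnK.
rewrite /powR gt_eqF ?expR_gt0 // expRK.
(* With [u = exp (a y)], use [exp t >= 1 + t] at [t = (1 - a) y] and [t = - a y]. *)
have h1 := expR_ge1Dx ((1 - a) * y); have h2 := expR_ge1Dx (- (a * y)).
have E1 : expR y = expR (a * y) * expR ((1 - a) * y).
  by rewrite -expRD; congr expR; lra.
have E2 : 1 = expR (a * y) * expR (- (a * y)) by rewrite expRxMexpNx_1.
have u0 := expR_gt0 (a * y).
move: (expR (a * y)) (expR ((1 - a) * y)) (expR (- (a * y))) E1 E2 h1 h2 u0 => u v w.
move=> -> uw h1 h2 u0.
have : u * (a * v + (1 - a) * w) >= u * 1.
  rewrite ler_pM2l //.
  have := ler_wpM2l (ltW a0) h1; have a1' : 0 <= 1 - a by lra.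
  have := ler_wpM2l a1' h2; nra.
nra.
Qed.

(** Power mean inequality: [s] bounds the mean of the squared singular values. *)
Lemma schatten_norm_le (R : realType) (p : R) (n : nat) (A : 'M[R]_n) (s : R) :
    1 <= p <= 2 -> 0 < s -> frob2 A <= n%:R * s ->
  schatten_norm p A <= n%:R `^ p^-1 * Num.sqrt s.
Proof.
move=> /andP[p1 p2] s0 As.
(* Tangent at [s] of the concave map t^(p/2), taken at the squared singular value; the linear
   corrections sum to a nonpositive quantity. *)
have bound i : singular_value A i `^ p <=
    s `^ (p / 2) * (1 + p / 2 * (singular_value A i ^+ 2 / s - 1)).
  have sv0 : 0 <= singular_value A i by exact: sqrtr_ge0.
  have -> : singular_value A i `^ p =
      s `^ (p / 2) * (singular_value A i ^+ 2 / s) `^ (p / 2).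
    rewrite -powRM ?divr_ge0 ?sqr_ge0 1?ltW // mulrCA divff ?gt_eqF // mulr1.
    rewrite -powR_mulrn // -powRrM; congr (_ `^ _); lra.
  by rewrite ler_wpM2l ?powR_ge0 // powR_tangent ?divr_ge0 ?sqr_ge0 ?(ltW s0) //; lra.
have sum_le : \sum_i singular_value A i `^ p <= n%:R * s `^ (p / 2).
  apply: le_trans (ler_sum _ (fun i _ => bound i)) _.
  rewrite -mulr_sumr mulrC ler_wpM2r ?powR_ge0 //.
  rewrite big_split /= sumr_const card_ord -mulr_sumr sumrB -mulr_suml.
  rewrite sum_singular_value_sq sumr_const card_ord gerDl.
  rewrite mulr_ge0_le0 ?divr_ge0 //; first lra.
  by rewrite subr_le0 ler_pdivrMr.
rewrite /schatten_norm; have pi0 : 0 <= p^-1 by rewrite invr_ge0; lra.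
apply: le_trans (ge0_ler_powR pi0 _ _ sum_le) _.
- by rewrite nnegrE sumr_ge0 // => i _; exact: powR_ge0.
- by rewrite nnegrE mulr_ge0 ?powR_ge0.
rewrite powRM ?powR_ge0 // -powRrM -powR12_sqrt ?(ltW s0)//.
have -> // : p / 2 / p = 2^-1 by field; lra.
Qed.

(** * A numerical bound on the normal tail *)

Lemma normal_tail_le (R : realType) (x : R) : 3 <= x -> normal_tail x <= 1 / 4.
Proof.
move=> x3; rewrite /normal_tail /Rintegral.
set J := (\int[_]_(s in _) _)%E.
have mJ : measurable (`[x, +oo[%classic : set R) by exact: measurable_itv.
have mexp : measurable_fun [set: R] (fun s => (exponential_pdf (1 : R) s)%:E : \bar R).
  by apply/measurable_EFinP; exact: measurable_exponential_pdf.
have J0 : (0 <= J)%E by apply: integral_ge0 => s _; rewrite lee_fin expR_ge0.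
have Jle : (J <= (1 / 2)%:E)%E.
  have -> : ((1 / 2)%:E = (1 / 2)%:E *
      \int[lebesgue_measure]_s (exponential_pdf 1 s)%:E :> \bar R)%E.
    by rewrite integral_exponential_pdf // mule1.
  rewrite -ge0_integralZl //; last first.
    by move=> s _; rewrite lee_fin exponential_pdf_ge0.
  apply: (@le_trans _ _ (\int[lebesgue_measure]_(s in `[x, +oo[)
      ((1 / 2)%:E * (exponential_pdf 1 s)%:E))%E).
    apply: ge0_le_integral => //.
    - apply/measurable_EFinP; apply: measurableT_comp => //.
      apply: measurable_funTS; apply: measurableT_comp => //.
      by apply: measurable_funM => //; exact: measurable_funX.
    - by apply: measurable_funTS; apply: emeasurable_funM.
    - move=> s /=; rewrite in_itv /= andbT => xs.
      rewrite lee_fin exponential_pdfE; last by lra.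
      have h : expR (-1) <= 1 / 2 :> R.
        have := expR_ge1Dx (1 : R); have := expRxMexpNx_1 (1 : R).
        by have := expR_gt0 (-1 : R); nra.
      (* For s >= 3, s^2 / 2 >= s + 1; with e^(-1) <= 1/2 this puts the Gaussian below half the
         exponential density. *)
      apply: (@le_trans _ _ (expR (-1) * expR (- s))).
        by rewrite -expRD ler_expR; nra.
      by rewrite mulN1r !mul1r ler_wpM2r ?expR_ge0 //; lra.
  apply: ge0_subset_integral => //.
  - by apply: emeasurable_funM.
  - by move=> s _; rewrite mule_ge0 // lee_fin ?exponential_pdf_ge0 //; lra.
have Jfin : J \is a fin_num.
  by rewrite ge0_fin_numE // (le_lt_trans Jle) // ltry.
have fJ0 : 0 <= fine J by exact: fine_ge0.
have fJ : fine J <= 1 / 2 by rewrite -lee_fin fineK.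
have s2 : 2 <= Num.sqrt (2 * pi) :> R.
  rewrite -[leLHS]ger0_norm // -sqrtr_sqr ler_wsqrtr //.
  by have := pi_ge2 R; lra.
have : (Num.sqrt (2 * pi))^-1 <= 1 / 2 :> R.
  by rewrite mul1r lef_pV2 ?posrE //; lra.
have : 0 <= (Num.sqrt (2 * pi))^-1 :> R by rewrite invr_ge0; lra.
by move: (Num.sqrt _)^-1 (fine J) fJ0 fJ => a b; nra.
Qed.

(** * Runs of an algorithm: measurability and perturbation *)

Lemma measurable_bool_tuple (k : nat) (X : set (k.-tuple bool)) : measurable X.
Proof.
have -> : X = \bigcup_(t in X) [set t].
  by apply/seteqP; split=> [t Xt|t [u Xu /= ->]//]; exists t.
apply: fin_bigcup_measurable => [|t _]; first exact: finite_finset.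
have -> : [set t] = \bigcap_(i in [set: 'I_k]) ((@tnth k bool)^~ i @^-1` [set tnth t i]).
  apply/seteqP; split=> [u -> //|u ut].
  by apply: eq_from_tnth => i; exact: ut.
apply: fin_bigcap_measurable => [|i _]; first exact: finite_finset.
rewrite -[X in measurable X]setTI.
exact: (measurable_tnth i).
Qed.

Section run_properties.
Context (R : realType) (d : measure_display) (Omega : measurableType d).
Context (k n m : nat) (alg : mv_algorithm R Omega k n m).

Lemma measurable_transcript (A : 'M[R]_n) (i : nat) :
  measurable_fun [set: Omega] (fun w => transcript alg A w i).
Proof.
elim: i => [|i IH] /=; first exact: measurable_cst.
have mpair : measurable_fun setT (fun w => (w, transcript alg A w i)).
  by apply: measurable_fun_pair => //; exact: measurable_id.
have mq : measurable_fun setT (fun w => query alg (w, transcript alg A w i)).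
  exact: (measurableT_comp (@measurable_query _ _ _ _ _ _ alg i) mpair).
apply/measurable_fun_tnthP => j.
have [ji|ij] := ltnP j i.
  rewrite (_ : _ \o _ = (fun w => tnth (transcript alg A w i) (Ordinal ji))).
    exact: (measurableT_comp (measurable_tnth (Ordinal ji)) IH).
  apply/funext => w /=; rewrite !(tnth_nth [tuple 0 | _ < n]) /= nth_rcons.
  by rewrite size_tuple ji.
rewrite (_ : _ \o _ = fun w =>
    answer A (query_vector alg (query alg (w, transcript alg A w i)))).
  apply/measurable_fun_tnthP => l.
  rewrite (_ : _ \o _ = fun w => \sum_h A l h *
      decode_bits alg (tnth (query alg (w, transcript alg A w i)) h)).
    apply: (@measurable_sum _ _ _ setT _ _ (fun h w => A l h *
      decode_bits alg (tnth (query alg (w, transcript alg A w i)) h))) => h.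
    apply: measurable_funM => //.
    apply: (@measurableT_comp _ _ _ _ _ _ (decode_bits alg)).
      (* The number format is arbitrary, but every set of bit strings is measurable. *)
      by move=> _ Y _; exact: measurable_bool_tuple.
    exact: (measurableT_comp (measurable_tnth h) mq).
  apply/funext => w /=; rewrite tnth_mktuple mxE.
  by apply: eq_bigr => h _; rewrite mxE.
apply/funext => w /=; rewrite (tnth_nth [tuple 0 | _ < n]) /= nth_rcons.
have -> : nat_of_ord j = i by have := ltn_ord j; lia.
by rewrite size_tuple ltnn eqxx.
Qed.

Lemma measurable_estimate (A : 'M[R]_n) :
  measurable_fun [set: Omega] (estimate alg A).
Proof.
apply: (@measurableT_comp _ _ _ _ _ _ (output alg)); first exact: measurable_output.
by apply: measurable_fun_pair; [exact: measurable_id | exact: measurable_transcript].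
Qed.

Lemma measurable_success (A : 'M[R]_n) (t r : R) :
  measurable [set w | `|estimate alg A w - t| <= r].
Proof.
rewrite -[X in measurable X]setTI.
rewrite (_ : [set w | _] = (fun w => `|estimate alg A w - t|) @^-1` `]-oo, r]).
  have mf : measurable_fun setT (fun w => `|estimate alg A w - t|).
    apply: measurableT_comp => //; apply: measurable_funB => //.
    exact: measurable_estimate.
  exact: mf.
by apply/seteqP; split => w /=; rewrite in_itv.
Qed.

(** Kept as bit strings, the record of a run lies in a finite type, so that one perturbation can be
    chosen for each record. *)
Definition queries (A : 'M[R]_n) (w : Omega) :
    {ffun 'I_m -> n.-tuple (k.-tuple bool)} :=
  [ffun i : 'I_m => query alg (w, transcript alg A w i)].

Definition query_vectors (Q : {ffun 'I_m -> n.-tuple (k.-tuple bool)}) :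
    seq 'cV[R]_n := [seq query_vector alg (Q i) | i <- enum 'I_m].

(** Equal transcripts give the same next query, which [B] kills, hence the same answer. *)
Lemma transcript_perturb (A B : 'M[R]_n) (w : Omega) :
    (forall q, q \in query_vectors (queries A w) -> B *m q = 0) ->
  forall i, (i <= m)%N -> transcript alg (A + B) w i = transcript alg A w i.
Proof.
move=> B0; elim=> [//|i IH] im; rewrite /= IH 1?ltnW //.
set q := query_vector _ _; have qq : q \in query_vectors (queries A w).
  by apply/mapP; exists (Ordinal im); rewrite ?mem_enum // ffunE.
have -> // : answer (A + B) q = answer A q.
by apply: eq_from_tnth => l; rewrite !tnth_mktuple mulmxDl B0 // addr0.
Qed.

(** The shift preserves the record, so a perturbation chosen from the record of [A] can be recovered
    from [A + B]. *)
Lemma queries_perturb (A B : 'M[R]_n) (w : Omega) :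
    (forall q, q \in query_vectors (queries A w) -> B *m q = 0) ->
  queries (A + B) w = queries A w.
Proof.
move=> B0; apply/ffunP => i; rewrite !ffunE transcript_perturb //.
exact: ltnW.
Qed.

Lemma estimate_perturb (A B : 'M[R]_n) (w : Omega) :
    (forall q, q \in query_vectors (queries A w) -> B *m q = 0) ->
  estimate alg (A + B) w = estimate alg A w.
Proof. by move=> B0; rewrite /estimate transcript_perturb. Qed.

End run_properties.

(** * Two probability inequalities *)

Lemma disjoint_probability_le (R : realType) (d : measure_display)
    (T : measurableType d) (P : probability T R) (E F : set T) :
    measurable E -> measurable F -> E `&` F = set0 ->
  fine (P E) + fine (P F) <= 1.
Proof.
move=> mE mF EF0; rewrite -fineD ?fin_num_measure // -measureU //.
rewrite -lee_fin fineK ?fin_num_measure ?probability_le1 //; exact: measurableU.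
Qed.

(** The averaging step of Yao's principle: a bound on the weight of the good inputs, valid for every
    fixed seed, is integrated over the seed. *)
Lemma weighted_probability_le (R : realType) (d : measure_display)
    (T : measurableType d) (P : probability T R) (J : finType) (c : J -> R)
    (E : J -> set T) (K : R) :
    (forall j, 0 <= c j) -> (forall j, measurable (E j)) ->
    (forall w, \sum_j c j * \1_(E j) w <= K) ->
  \sum_j c j * fine (P (E j)) <= K.
Proof.
move=> c0 mE le_K.
have PE j : P (E j) = (fine (P (E j)))%:E by rewrite fineK // fin_num_measure.
have mI j : measurable_fun setT (fun w => (\1_(E j) w)%:E : \bar R).
  by apply/measurable_EFinP; exact: measurable_indic.
have mc j : measurable_fun setT (fun w => (c j)%:E * (\1_(E j) w)%:E)%E.
  by apply: emeasurable_funM.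
rewrite -lee_fin.
have -> : (\sum_j c j * fine (P (E j)))%:E =
    (\int[P]_w (\sum_j (c j)%:E * (\1_(E j) w)%:E))%E.
  rewrite ge0_integral_sum //; last by move=> j w _; rewrite mule_ge0 // lee_fin.
  rewrite -sumEFin; apply: eq_bigr => j _.
  rewrite ge0_integralZl ?lee_fin // integral_indic // setIT.
  by rewrite EFinM -PE.
apply: (@le_trans _ _ (\int[P]_w cst K%:E w)%E).
  apply: ge0_le_integral => //.
  - by move=> w _; apply: sume_ge0 => j _; rewrite mule_ge0 // lee_fin.
  - exact: emeasurable_sum.
  - by move=> w _; under eq_bigr do rewrite -EFinM; rewrite sumEFin lee_fin.
by rewrite integral_cst //; have := probability_setT P => /= ->; rewrite mule1.
Qed.

(** * Lower bound in a fixed dimension *)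

Section lower_bound.
Context (R : realType) (d : measure_display) (Omega : measurableType d).
Context (P : probability Omega R) (p eps : R).
Hypotheses (p12 : 1 <= p <= 2) (eps0 : 0 < eps).

Definition succeeds (k n m : nat) (alg : mv_algorithm R Omega k n m)
    (A : 'M[R]_n) (w : Omega) : bool :=
  `|estimate alg A w - \tr A| <= eps * schatten_norm p A.

(** Without queries, 1 and -1 get the same estimate, and intervals of radius below 1 around them are
    disjoint; two disjoint events cannot both have probability 7/8. *)
Lemma queries_gt0 (k m : nat) (alg : mv_algorithm R Omega k 1 m) :
    eps < 1 ->
    (forall A : 'M[R]_1, 7 / 8 <= fine (P [set w | succeeds alg A w])) ->
  (0 < m)%N.
Proof.
move=> eps1 algP; case: m alg algP => // alg algP.
have norm1 (a : R) : a ^+ 2 = 1 -> eps * schatten_norm p (a%:M : 'M[R]_1) <= eps.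
  move=> a1; rewrite ger_pMr //.
  rewrite (le_trans (@schatten_norm_le _ p 1 a%:M 1 p12 ltr01 _)) //.
    by rewrite frob2E !big_ord1 mxE eqxx mulr1n a1 mulr1.
  by rewrite powR1 sqrtr1 mul1r.
have sameE w : estimate alg (- 1)%:M w = estimate alg 1%:M w.
  have -> : (- 1)%:M = 1%:M + ((- 1)%:M - 1%:M) :> 'M[R]_1 by rewrite addrC subrK.
  by apply: estimate_perturb => q; rewrite /query_vectors (size0nil (size_enum_ord 0)).
have excl : [set w | succeeds alg 1%:M w] `&` [set w | succeeds alg (- 1)%:M w] = set0.
  apply/seteqP; split=> // w [] /=; rewrite /succeeds sameE.
  rewrite !mxtrace_scalar !mulr1n => s1 s2; exfalso.
  have {s1} := le_trans s1 (norm1 1 (expr1n _ _)).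
  have {s2} := le_trans s2 (norm1 (- 1) (etrans (sqrrN 1) (expr1n _ 2))).
  by rewrite !ler_norml => /andP[? ?] /andP[? ?]; lra.
have contra (a b : R) : 7 / 8 <= a -> 7 / 8 <= b -> a + b <= 1 -> false by lra.
apply: contra (algP 1%:M) (algP (- 1)%:M) _.
by apply: disjoint_probability_le excl; exact: measurable_success.
Qed.

Context (k n m : nat) (alg : mv_algorithm R Omega k n m).
Hypotheses (n0 : (0 < n)%N) (epsn : eps * n%:R `^ p^-1 <= 1 / 40).

(** Here 144 = 16 * 9, where 9 is the constant of the second moment bound [moment]; Markov's
    inequality then loses 1/16 of the weight. *)
Let moderate (A : 'M[R]_n) : bool := frob2 A <= 144 * n%:R ^+ 2.

(** Success on both matrices would give |tr B| <= 2 (12/40) sqrt n, which is below sqrt (n/2) >=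
    (7/10) sqrt n. *)
Lemma success_separated (A B : 'M[R]_n) (w : Omega) :
    (forall q, q \in query_vectors alg (queries alg A w) -> B *m q = 0) ->
    Num.sqrt (n%:R / 2) <= `|\tr B| ->
    succeeds alg A w && moderate A ->
  ~~ (succeeds alg (A + B) w && moderate (A + B)).
Proof.
have nR : 0 < n%:R :> R by rewrite ltr0n.
pose r : R := Num.sqrt n%:R; have r0 : 0 < r by rewrite sqrtr_gt0.
have sq : 7 / 10 * r <= Num.sqrt (n%:R / 2).
  rewrite sqrtrM // -/r mulrC ler_wpM2l ?(ltW r0) //.
  rewrite -[leLHS]ger0_norm; last by lra.
  by rewrite -sqrtr_sqr ler_wsqrtr //; lra.
have sr : Num.sqrt (144 * n%:R) = 12 * r :> R.
  rewrite sqrtrM // -/r; congr (_ * _).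
  by rewrite (_ : 144 = 12 ^+ 2) ?sqrtr_sqr ?ger0_norm //; lra.
have eps_r : eps * (n%:R `^ p^-1 * (12 * r)) <= 12 / 40 * r.
  rewrite mulrA; have := ler_wpM2r (ltW (mulr_gt0 (ltr0n R 12) r0)) epsn; lra.
have norm_le C : moderate C -> eps * schatten_norm p C <= 12 / 40 * r.
  move=> mC; apply: le_trans eps_r; rewrite ler_pM2l // -sr.
  apply: schatten_norm_le => //; first by rewrite mulr_gt0.
  by apply: le_trans mC _; rewrite [leRHS]mulrCA -expr2.
move=> Bq trB /andP[sA mA]; apply/negP => /andP[].
rewrite /succeeds estimate_perturb // mxtraceD => sAB mAB.
have {sAB} := le_trans sAB (norm_le _ mAB); have {sA} := le_trans sA (norm_le _ mA).
rewrite !ler_norml => /andP[? ?] /andP[? ?].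
have : `|\tr B| <= 24 / 40 * r by rewrite ler_norml; lra.
by lra.
Qed.

(** If 2m <= n, each seed is good on at most 17/24 of the weight, whereas the success probability
    forces at least (7/8)(15/16), which is larger. *)
Lemma queries_linear :
    (forall A : 'M[R]_n, 7 / 8 <= fine (P [set w | succeeds alg A w])) ->
  (n < m.*2)%N.
Proof.
move=> algP; rewrite ltnNge; apply/negP => mn.
pose QT := {ffun 'I_m -> n.-tuple (k.-tuple bool)}.
have /choice[B BP] : forall Q : QT, exists B : 'M[R]_n, [/\ frob2 B = 1,
    forall q, q \in query_vectors alg Q -> B *m q = 0 &
    Num.sqrt (n%:R / 2) <= \tr B].
  by move=> Q; apply: invisible_perturbation; rewrite // size_map size_enum_ord.
(* Shifts by [B Q] carry the indistinguishability argument; shifts by elementary matrices bound the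
   second moments of the entries. *)
pose g (i : QT + 'I_n * 'I_n) : 'M[R]_n :=
  match i with inl Q => B Q | inr ij => delta_mx ij.1 ij.2 end.
pose f := @gauss_weight R n.
have f0 A : 0 <= f A by exact: gauss_weight_ge0.
have [L growth] : exists L, box_sum g L.+1 f <= (1 + 1 / 16) * box_sum g L f.
  apply: box_sum_growth; last by lra.
  - by move=> A; rewrite f0 gauss_weight_le1.
  - exact: gauss_weight0.
set F := box_sum g L f in growth.
have F0 : 0 < F.
  rewrite /F /box_sum (bigD1 [ffun=> ord0]) //= ltr_pwDl ?expR_gt0 //.
  by apply: sumr_ge0 => z _.
(* With M the left-hand side, the two shifts give F + M/8 <= 2 (17/16) F, that is M <= 9 F. *)
have entry i j : box_sum g L (fun A => f A * A i j ^+ 2) <= 9 * F.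
  pose e : QT + 'I_n * 'I_n := inr (i, j).
  have le_shift A : f A + 1 / 8 * (f A * A i j ^+ 2) <= f (A + g e) + f (A - g e).
    apply: le_trans (gauss_weight_shift A (frob2_delta R i j)).
    by rewrite frob_dot_delta -/f; lra.
  have := le_box_sum g L le_shift.
  rewrite !box_sumD box_sumZ -/F.
  by have := box_sum_shift g L e f0; have := box_sum_shiftN g L e f0; lra.
have nR : 0 < n%:R :> R by rewrite ltr0n.
pose N : R := n%:R ^+ 2; have N0 : 0 < N by rewrite exprn_gt0.
have moment : box_sum g L (fun A => f A * frob2 A) <= 9 * N * F.
  have -> : (fun A => f A * frob2 A) =
      (fun A => \sum_i \sum_j (f A * A i j ^+ 2)).
    apply/funext => A; rewrite frob2E mulr_sumr.
    by apply: eq_bigr => i _; rewrite mulr_sumr.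
  rewrite box_sum_sum; under eq_bigr do rewrite box_sum_sum.
  apply: le_trans (ler_sum _ (fun i _ => ler_sum _ (fun j _ => entry i j))) _.
  by rewrite !sumr_const !card_ord -mulrnA -[_ *+ (n * n)]mulr_natr natrM -expr2 -/N mulrAC.
have moderate_mass : 15 / 16 * F <= box_sum g L (fun A => f A * (moderate A)%:R).
  have markov A : f A <= f A * (moderate A)%:R + (144 * N)^-1 * (f A * frob2 A).
    rewrite /moderate -/N; have [_|big] := leP (frob2 A) (144 * N).
      rewrite mulr1 lerDl mulr_ge0 ?invr_ge0 ?mulr_ge0 ?frob2_ge0 //; exact: ltW.
    rewrite mulr0 add0r mulrCA ler_peMr // mulrC ler_pdivlMr ?mul1r 1?ltW //.
    by rewrite mulr_gt0.
  have := le_box_sum g L markov; rewrite box_sumD box_sumZ -/F.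
  have : (144 * N)^-1 * box_sum g L (fun A => f A * frob2 A) <= 1 / 16 * F.
    rewrite mulrC ler_pdivrMr ?mulr_gt0 //; lra.
  by lra.
pose S w A := succeeds alg A w && moderate A.
(* With G the left-hand side, [bad] and [split] give G <= 2 (17/16 F - G), whence 17/24. *)
have good_mass w : box_sum g L (fun A => f A * (S w A)%:R) <= 17 / 24 * F.
  (* [h] splits the failing weight by record: within one class the shift [B Q] is constant, so
     almost invariance applies to it. *)
  pose h (Q : QT) A := f A * (~~ S w A)%:R * (queries alg A w == Q)%:R.
  have h0 Q A : 0 <= h Q A by rewrite !mulr_ge0.
  have le_h A : f A * (S w A)%:R <= \sum_Q (h Q (A + B Q) + h Q (A - B Q)).
    have [SA|_] := boolP (S w A); last first.
      by rewrite mulr0 sumr_ge0 // => Q _; rewrite addr_ge0.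
    set Q := queries alg A w; have [B1 Bq trB] := BP Q.
    have NBq q : q \in query_vectors alg Q -> - B Q *m q = 0.
      by move=> /Bq Bq0; rewrite mulNmx Bq0 oppr0.
    rewrite (bigD1 Q) //= mulr1 -[leLHS]addr0 lerD //; last first.
      by rewrite sumr_ge0 // => Q' _; rewrite addr_ge0.
    have hE D : (forall q, q \in query_vectors alg Q -> D *m q = 0) ->
        `|\tr D| = \tr (B Q) -> h Q (A + D) = f (A + D).
      move=> Dq trD; rewrite /h /S (success_separated Dq _ SA) ?trD //.
      by rewrite queries_perturb // eqxx !mulr1.
    have normB : `|\tr (B Q)| = \tr (B Q).
      by rewrite ger0_norm // (le_trans _ trB) ?sqrtr_ge0.
    rewrite !hE //; last by rewrite linearN normrN.
    apply: le_trans (gauss_weight_shift A B1); rewrite -/f ler_peMr //.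
    by have := sqr_ge0 (frob_dot A (B Q)); lra.
  have bad : box_sum g L (fun A => f A * (S w A)%:R) <=
      2 * box_sum g L.+1 (fun A => f A * (~~ S w A)%:R).
    apply: le_trans (le_box_sum g L le_h) _.
    have -> : (fun A => f A * (~~ S w A)%:R) = (fun A => \sum_Q h Q A).
      apply/funext => A; rewrite (bigD1 (queries alg A w)) //= big1 => [|Q QA].
        by rewrite /h eqxx mulr1 addr0.
      by rewrite /h eq_sym (negbTE QA) mulr0.
    rewrite !box_sum_sum mulr_sumr; apply: ler_sum => Q _.
    rewrite box_sumD; have := box_sum_shift g L (inl Q) (h0 Q).
    by have := box_sum_shiftN g L (inl Q) (h0 Q); rewrite /=; lra.
  have split : box_sum g L.+1 f = box_sum g L.+1 (fun A => f A * (S w A)%:R) +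
      box_sum g L.+1 (fun A => f A * (~~ S w A)%:R).
    rewrite -box_sumD; congr box_sum; apply/funext => A.
    by case: (S w A); rewrite /= mulr1 mulr0 ?addr0 ?add0r.
  have := @box_sumS _ _ _ g L (fun A => f A * (S w A)%:R).
  by move=> /(_ (fun A => mulr_ge0 (f0 A) (ler0n _ _))); lra.
pose c (z : {ffun (QT + 'I_n * 'I_n) -> 'I_(L.*2.+1)}) : R :=
  f (box_point g z) * (moderate (box_point g z))%:R.
have c0 z : 0 <= c z by rewrite mulr_ge0.
have := @weighted_probability_le _ _ _ P _ c
  (fun z => [set w | succeeds alg (box_point g z) w]) (17 / 24 * F) c0.
move=> /(_ (fun z => measurable_success alg _ _ _)) H.
have : 7 / 8 * box_sum g L (fun A => f A * (moderate A)%:R) <= 17 / 24 * F.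
  apply: le_trans (H _).
    rewrite /box_sum mulr_sumr; apply: ler_sum => z _.
    by rewrite -/(c z) mulrC ler_wpM2l.
  move=> w; apply: le_trans (good_mass w); rewrite /box_sum.
  apply: ler_sum => z _; rewrite /c indicE -mulrA ler_wpM2l // -natrM mulnb.
  rewrite /S andbC ler_nat; have [|//] := boolP (w \in _).
  by rewrite inE /= => ->.
by lra.
Qed.

End lower_bound.

(** * Choice of the dimension and of the constant *)

Theorem theoremC2 (R : realType) :
  let delta : R := normal_tail (201%:R / 100%:R * 66%:R) in
  exists c : R, 0 < c /\
  forall (p : R) (k : nat) (eps : R)
    (d : measure_display) (Omega : measurableType d) (P : probability Omega R)
    (m : nat -> nat) (alg : forall n : nat, mv_algorithm R Omega k n (m n)),
  1 <= p <= 2 -> (1 <= k)%N -> 0 < eps < 1 ->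
  (forall (n : nat) (A : 'M[R]_n), (0 < n)%N ->
     (P [set w | (`|estimate (alg n) A w - \tr A| <= eps * schatten_norm p A)%R]
        >= (1 - delta / 2)%:E)%E) ->
  exists n : nat, (0 < n)%N /\
    c / (eps `^ p * (k%:R + ln eps^-1)) <= (m n)%:R.
Proof.
move=> delta; exists (1 / 3200); split; first by lra.
move=> p k eps d Omega P m alg p12 k1 /andP[eps0 eps1] algP.
(* As 2.01 * 66 >= 3, this makes the success probability at least 7/8. *)
have delta_le : delta <= 1 / 4 by apply: normal_tail_le; lra.
have alg78 n (A : 'M[R]_n) : (0 < n)%N ->
    7 / 8 <= fine (P [set w | succeeds p eps (alg n) A w]).
  move=> n0; rewrite -lee_fin fineK; last first.
    by apply: fin_num_measure; exact: measurable_success.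
  by apply: le_trans (algP n A n0); rewrite lee_fin; lra.
pose x := eps `^ p; have x0 : 0 < x by exact: powR_gt0.
(* The factor k + ln (1/eps) is at least 1, so it suffices to reach 1 / (3200 eps^p). *)
have le_x (a : R) : 0 < a -> a / (x * (k%:R + ln eps^-1)) <= a / x.
  move=> a0; have k1R : 1 <= k%:R :> R by rewrite ler1n.
  have ln0 : 0 <= ln eps^-1 by rewrite ln_ge0 // invf_ge1 // ltW.
  have u1 : 1 <= k%:R + ln eps^-1 by lra.
  have u0 := lt_le_trans ltr01 u1.
  by rewrite ler_pM2l // lef_pV2 ?posrE ?mulr_gt0 // ler_peMr // ltW.
(* If 1600 eps^p > 1, the target is below 1 and a single query in dimension 1 reaches it. *)
have [x_small|x_big] := leP (1600 * x) 1; last first.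
  exists 1%N; split=> //.
  have m1 : (0 < m 1)%N.
    by apply: (queries_gt0 (P := P) p12 eps0 (alg := alg 1%N) eps1) => A; exact: alg78.
  apply: (@le_trans _ _ (1 / 3200 / x)); first by apply: le_x; lra.
  apply: (@le_trans _ _ 1); last by rewrite ler1n.
  by rewrite ler_pdivrMr //; lra.
(* The largest dimension with n eps^p <= 1/1600. *)
pose y : R := 1 / 1600 / x; pose n := Num.truncn y.
have y1 : 1 <= y by rewrite /y ler_pdivlMr //; lra.
have n0 : (0 < n)%N by rewrite truncn_gt0.
have ny : n%:R <= y by rewrite truncn_le //; lra.
have nx : n%:R * x <= 1 / 1600.
  by apply: le_trans (ler_wpM2r (ltW x0) ny) _; rewrite /y divfK // gt_eqF.
exists n; split=> //.
apply: (@le_trans _ _ (1 / 3200 / x)); first by apply: le_x; lra.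
have p0 : 0 < p by lra.
have epsn : eps * n%:R `^ p^-1 <= 1 / 40.
  have -> : eps * n%:R `^ p^-1 = (n%:R * x) `^ p^-1.
    by rewrite powRM ?(ltW x0) // /x -powRrM divff ?gt_eqF // powRr1 ?(ltW eps0) // mulrC.
  apply: (@le_trans _ _ ((1 / 1600) `^ p^-1)).
    have pV0 : 0 <= p^-1 by rewrite invr_ge0 ltW.
    have nx0 : 0 <= n%:R * x by rewrite mulr_ge0 // ltW.
    by apply: (ge0_ler_powR pV0) nx; rewrite nnegrE; lra.
  (* The base is below 1, so p = 2 is the worst case, and it gives exactly 1/40. *)
  apply: (@le_trans _ _ ((1 / 1600) `^ 2^-1)).
    by apply: ger_powR; [lra | rewrite lef_pV2 ?posrE; lra].
  rewrite powR12_sqrt; last lra.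
  have -> : 1 / 1600 = (1 / 40) ^+ 2 :> R by lra.
  by rewrite sqrtr_sqr ger0_norm; lra.
have nm := queries_linear p12 eps0 n0 epsn (fun A => alg78 n A n0).
(* Rounding [y] down costs nothing: n < 2m between integers gives y < n + 1 <= 2m. *)
have : n%:R + 1 <= 2 * (m n)%:R :> R by rewrite natr1 -natrM ler_nat mul2n.
have : y < n%:R + 1 by rewrite natr1 truncnS_gt.
have -> : 1 / 3200 / x = y / 2 by rewrite /y; lra.
lra.
Qed.
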